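(* (a) Consider the family of affine resource cost functions $\mathcal{L}=\mathrm{span}(b_1,b_2)$ with $b_1(x)=1$ and $b_2(x)=x$ (linear combinations with nonnegative coefficients), and let $\mathcal{G}_0$ be the family of affine congestion games without taxes. Then, for all $\tau\in[1,5/2]$, $${\rm PoS}(\mathcal{G}_0^\tau)\le\min\left\{\tau,\ {\rm PoS}(\mathcal{G}_0),\ -\tfrac43\tau+\tfrac{13}{3}\right\},$$ where ${\rm PoS}(\mathcal{G}_0)=1+\sqrt3/3\approx1.577$. (b) Consider the family of quadratic resource cost functions $\mathcal{L}=\mathrm{span}(b_1,b_2,b_3)$ with $b_1(x)=1$, $b_2(x)=x$ and $b_3(x)=x^2$ (linear combinations with nonnegative coefficients), and let $\mathcal{G}_0$ be the family of quadratic congestion games without taxes. Then, for all $\tau\in[1,115/12]$, $${\rm PoS}(\mathcal{G}_0^\tau)\le\min\left\{\tau,\ {\rm PoS}(\mathcal{G}_0),\ -\tfrac13\tau+\tfrac{151}{36}\right\},$$ where ${\rm PoS}(\mathcal{G}_0)\approx2.361$.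
   Context: An (atomic) congestion game without taxes consists of a finite set of users $N=\{1,\dots,n\}$ (here $n$ is arbitrary), a set of resources $\mathcal{E}$, for each user $i$ a set of feasible actions $\mathcal{A}_i\subseteq 2^{\mathcal{E}}$, and for each resource $e$ a resource cost function $\ell_e\in\mathcal{L}$ of the number of users on $e$. For an assignment $a\in\mathcal{A}=\prod_{i\in N}\mathcal{A}_i$, let $|a|_e$ be the number of users $i$ with $e\in a_i$. User $i$ incurs cost $C_i(a)=\sum_{e\in a_i}\ell_e(|a|_e)$ and the system cost is ${\rm SC}(a)=\sum_{i\in N}C_i(a)$. A pure Nash equilibrium is an $a^{\rm ne}\in\mathcal{A}$ with $C_i(a^{\rm ne})\le C_i(a_i,a^{\rm ne}_{-i})$ for all $a_i\in\mathcal{A}_i$, $i\in N$; ${\rm NE}(G)$ is the (always nonempty) set of pure Nash equilibria of $G$, and ${\rm MinCost}(G)=\min_{a\in\mathcal{A}}{\rm SC}(a)$. For a family $\mathcal{G}$ of games, $${\rm PoA}(\mathcal{G})=\sup_{G\in\mathcal{G}}\max_{a\in{\rm NE}(G)}\frac{{\rm SC}(a)}{{\rm MinCost}(G)},\qquad {\rm PoS}(\mathcal{G})=\sup_{G\in\mathcal{G}}\min_{a\in{\rm NE}(G)}\frac{{\rm SC}(a)}{{\rm MinCost}(G)},$$ with ${\rm PoA}(G)={\rm PoA}(\{G\})$ for a single game. For a family $\mathcal{G}$ and $\tau\in[1,{\rm PoA}(\mathcal{G})]$, $\mathcal{G}^\tau:=\{G\in\mathcal{G}:{\rm PoA}(G)=\tau\}$.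 *)

(* Defs.v *)
From HB Require Import structures.
From mathcomp Require Import all_boot all_order all_algebra.
From mathcomp Require Import all_classical all_reals all_analysis.

Set Implicit Arguments.
Unset Strict Implicit.
Unset Printing Implicit Defensive.

Import Order.TTheory GRing.Theory Num.Theory.
Local Open Scope ring_scope.
Local Open Scope ereal_scope.

Record game (R : realType) := Game {
  num_users : nat;
  resource : finType;
  actions : 'I_num_users -> {set {set resource}};
  actions_neq0 : forall i, actions i != finset.set0;
  (* [cost e k] is the cost of e for each user on e when k users are on it *)
  cost : resource -> nat -> R }.

Definition assignment (R : realType) (G : game R) :=
  {ffun 'I_(num_users G) -> {set resource G}}.

Definition feasible (R : realType) (G : game R) (a : assignment G) : bool :=
  [forall i, a i \in actions i].

Definition load (R : realType) (G : game R) (a : assignment G)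
    (e : resource G) : nat :=
  #|[pred i | e \in a i]|.

Definition user_cost (R : realType) (G : game R) (a : assignment G)
    (i : 'I_(num_users G)) : R :=
  (\sum_(e in a i) cost e (load a e))%R.

Definition system_cost (R : realType) (G : game R) (a : assignment G) : R :=
  (\sum_i user_cost a i)%R.

Definition deviate (R : realType) (G : game R) (a : assignment G)
    (i : 'I_(num_users G)) (s : {set resource G}) : assignment G :=
  [ffun j => if j == i then s else a j].

Definition nash (R : realType) (G : game R) (a : assignment G) : bool :=
  feasible a &&
  [forall i, forall s in actions i,
     (user_cost a i <= user_cost (deviate a i s) i)%R].

Definition min_cost (R : realType) (G : game R) : \bar R :=
  \big[mine/+oo]_(a : assignment G | feasible a) (system_cost a)%:E.

(* The quotient 0 / 0 is read as 1, so that a game in which the optimum and an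
   equilibrium are both free has an efficient equilibrium; x / 0 = +oo for
   x > 0 is the library's convention. *)
Definition cost_ratio (R : realType) (x y : \bar R) : \bar R :=
  if (x == 0) && (y == 0) then 1 else x / y.

(* The set of pure Nash equilibria is finite and nonempty, so the neutral
   elements -oo and +oo of the next two operators play no role. *)
Definition worst_ratio (R : realType) (G : game R) : \bar R :=
  \big[maxe/-oo]_(a : assignment G | nash a)
     cost_ratio (system_cost a)%:E (min_cost G).

Definition best_ratio (R : realType) (G : game R) : \bar R :=
  \big[mine/+oo]_(a : assignment G | nash a)
     cost_ratio (system_cost a)%:E (min_cost G).

(* A family of games is a bare predicate because [game R] lives in a universe
   too large for the type of classical sets. *)
Definition PoA (R : realType) (F : game R -> Prop) : \bar R :=
  ereal_sup [set x | exists2 G, F G & x = worst_ratio G]%classic.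

Definition PoS (R : realType) (F : game R -> Prop) : \bar R :=
  ereal_sup [set x | exists2 G, F G & x = best_ratio G]%classic.

Definition with_PoA (R : realType) (F : game R -> Prop) (tau : R) :
    game R -> Prop :=
  fun G => F G /\ PoA (eq G) = tau%:E.

Definition cone_span (R : realType) (m : nat) (b : 'I_m -> nat -> R) :
    set (nat -> R) :=
  [set l | exists2 c : 'I_m -> R, (forall j, 0 <= c j)%R &
     forall x, l x = (\sum_j c j * b j x)%R]%classic.

Definition congestion_games (R : realType) (L : set (nat -> R)) :
    game R -> Prop :=
  fun G => forall e : resource G, L (cost e).

Definition monomial (R : realType) (m : nat) (j : 'I_m) (x : nat) : R :=
  (x%:R ^+ j)%R.

Definition affine_games (R : realType) : game R -> Prop :=
  congestion_games (cone_span (@monomial R 2)).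

Definition quadratic_games (R : realType) : game R -> Prop :=
  congestion_games (cone_span (@monomial R 3)).

Arguments affine_games R : clear implicits.
Arguments quadratic_games R : clear implicits.

(* v is x rounded to three decimals *)
Definition approx3 (R : realType) (x : \bar R) (v : R) : Prop :=
  `|x - v%:E| <= (1 / 2000)%:E.

(* Main.v *)
Require Import Defs.
From HB Require Import structures.
From mathcomp Require Import all_boot all_order all_algebra.
From mathcomp Require Import all_classical all_reals all_analysis.
From mathcomp Require Import ring lra.

(* Upper bounds.  Let [m] minimise Rosenthal's potential (hence [m] is a Nash
   equilibrium), let [ne] be the equilibrium realising the price of anarchy
   [tau] and [o] an optimum.  Adding, with nonnegative multipliers, the
   inequality potential m <= potential o and the equilibrium inequalities of
   [m] against [o], of [ne] against [m] and of [ne] against [o] gives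
   SC m + v * SC ne <= rho * SC o as soon as one inequality between the three
   loads of a resource holds for every monomial cost.  With v = 0 this bounds
   the price of stability; with v > 0 it bounds the cost of [m] by
   (rho - v * tau) * SC o.

   Lower bounds.  The first f of n users only use a shared resource of cost
   x^d.  Every other user i either joins it and also takes resources (i, j),
   for all other such j, or takes the resources (j, i) and a private one.  The
   weights are such that, once the users before i have joined, joining is a
   strictly better response for i whatever the later users do: hence the
   equilibrium is unique.  The ratio f / n is then optimised. *)

Set Implicit Arguments.
Unset Strict Implicit.
Unset Printing Implicit Defensive.

Import Order.TTheory GRing.Theory Num.Theory.
Local Open Scope ring_scope.

(** * Potential and equilibrium inequalities *)

Section CongestionGame.
Variables (R : realType) (G : game R).
Implicit Types (a b : assignment G) (i : 'I_(num_users G)).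

(** Deviations of [i] leave this number unchanged, so the costs of [i] before and after one are both
    expressed with it. *)
Definition other_load a i (e : resource G) : nat :=
  #|[pred j | (j != i) && (e \in a j)]|.

Lemma load_other a i e : load a e = ((e \in a i) + other_load a i e)%N.
Proof.
rewrite /load (cardD1 i) inE; congr addn.
Qed.

Lemma other_load_deviate a i s e :
  other_load (deviate a i s) i e = other_load a i e.
Proof.
by apply: eq_card => j; rewrite !inE ffunE; case: eqP.
Qed.

Lemma load_deviate a i s e :
  load (deviate a i s) e = ((e \in s) + other_load a i e)%N.
Proof. by rewrite (load_other _ i) other_load_deviate ffunE eqxx. Qed.

Lemma user_cost_other a i :
  user_cost a i = \sum_(e in a i) cost e (other_load a i e).+1.
Proof. by apply: eq_bigr => e ei; rewrite (load_other a i) ei. Qed.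

Lemma user_cost_deviate a i s :
  user_cost (deviate a i s) i = \sum_(e in s) cost e (other_load a i e).+1.
Proof.
rewrite user_cost_other ffunE eqxx.
by apply: eq_bigr => e _; rewrite other_load_deviate.
Qed.

Lemma feasible_deviate a i s :
  feasible a -> s \in actions i -> feasible (deviate a i s).
Proof.
move=> /forallP fa si; apply/forallP => j; rewrite ffunE.
by case: eqP => [->|].
Qed.

Lemma exists_feasible : exists a, feasible a.
Proof.
exists [ffun i => odflt finset.set0 [pick s in actions i]].
apply/forallP => i; rewrite ffunE; case: pickP => //= none.
have /set0Pn[s si] := @actions_neq0 _ G i.
by have := none s; rewrite si.
Qed.

Lemma sum_load b (F : resource G -> R) :
  \sum_i \sum_(e in b i) F e = \sum_e (load b e)%:R * F e.
Proof.
rewrite (exchange_big_dep predT) //=; apply: eq_bigr => e _.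
by rewrite sumr_const mulr_natl.
Qed.

Lemma system_cost_load a :
  system_cost a = \sum_e (load a e)%:R * cost e (load a e).
Proof. exact: sum_load. Qed.

Definition potential a : R :=
  \sum_e \sum_(k < load a e) cost e k.+1.

(** Only resources in exactly one of [s] and [a i] change their term, by the cost at
    [other_load + 1], which is what [i] pays there. *)
Lemma potential_deviate a i s :
  potential (deviate a i s) - potential a =
  user_cost (deviate a i s) i - user_cost a i.
Proof.
rewrite user_cost_deviate user_cost_other big_mkcond [X in _ = _ - X]big_mkcond.
rewrite /potential -!sumrB; apply: eq_bigr => e _.
rewrite load_deviate (load_other a i).
by case: (e \in s); case: (e \in a i); rewrite ?add0n ?add1n ?big_ord_recr /=; ring.
Qed.

Lemma exists_potential_min :
  exists2 m, nash m & forall b, feasible b -> potential m <= potential b.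
Proof.
have [a0 fa0] := exists_feasible.
case: (arg_minP potential fa0) => m fm mP; exists m => //.
apply/andP; split => //; apply/forallP => i; apply/forall_inP => s si.
rewrite -subr_ge0 -potential_deviate subr_ge0.
by apply: mP; apply: feasible_deviate.
Qed.

Hypothesis cost_ge0 : forall (e : resource G) k, 0 <= cost e k.
Hypothesis cost_homo : forall e : resource G,
  {homo @cost _ G e : j k / (j <= k)%N >-> j <= k}.

Lemma system_cost_ge0 a : 0 <= system_cost a.
Proof. by apply: sumr_ge0 => i _; apply: sumr_ge0. Qed.

(** If [i] moved to [b i], it would share each resource with at most [load a e] others; costs are
    monotone. *)
Lemma nash_system_cost a b : nash a -> feasible b ->
  system_cost a <= \sum_e (load b e)%:R * cost e (load a e).+1.
Proof.
move=> /andP[_ /forallP nasha] /forallP fb.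
rewrite -sum_load; apply: ler_sum => i _.
have /forall_inP/(_ _ (fb i)) := nasha i.
move=> /le_trans; apply; rewrite user_cost_deviate.
by apply: ler_sum => e _; apply: cost_homo; rewrite ltnS (load_other a i) leq_addl.
Qed.

End CongestionGame.

(** * Combining the inequalities with multipliers *)

Section Smoothness.
Variables (R : realType) (u v rho p s q r : R).

(* The loads of a resource in the potential minimiser, the equilibrium and the
   optimum are x, y and z; its cost function is l.  Users common to two of the
   assignments are ignored, which only weakens the equilibrium inequalities
   because l is nondecreasing. *)
Definition smooth_slack (l : nat -> R) (x y z : nat) : R :=
  rho * (z%:R * l z) - u * (x%:R * l x) - v * (y%:R * l y)
  + p * (\sum_(k < x) l k.+1 - \sum_(k < z) l k.+1)
  + s * (x%:R * l x - z%:R * l x.+1)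
  + q * (y%:R * l y - x%:R * l y.+1)
  + r * (y%:R * l y - z%:R * l y.+1).

(** The slack is linear in [l], so only monomial costs have to be checked. *)
Lemma smooth_slack_sum (m : nat) (c : 'I_m -> R) (h : 'I_m -> nat -> R) x y z :
  smooth_slack (fun k => \sum_j c j * h j k) x y z =
  \sum_j c j * smooth_slack (h j) x y z.
Proof.
have sum_swap n : \sum_(k < n) \sum_j c j * h j k.+1 =
    \sum_j c j * \sum_(k < n) h j k.+1.
  by rewrite exchange_big; apply: eq_bigr => j _; rewrite mulr_sumr.
rewrite /smooth_slack !sum_swap !mulr_sumr -!sumrB !mulr_sumr.
rewrite -!big_split /=; apply: eq_bigr => j _; ring.
Qed.

Hypotheses (p0 : 0 <= p) (s0 : 0 <= s) (q0 : 0 <= q) (r0 : 0 <= r).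

(** Summed over the resources, the slack is [rho * SC o - u * SC m - v * SC ne] plus nonnegative
    multiples of four differences, which [h1] to [h4] show to be nonpositive. *)
Lemma smooth_system_cost (G : game R) (m ne o : assignment G) :
  (forall (e : resource G) k, 0 <= cost e k) ->
  (forall e : resource G, {homo @cost _ G e : j k / (j <= k)%N >-> j <= k}) ->
  (forall (e : resource G) x y z, 0 <= smooth_slack (cost e) x y z) ->
  nash m -> (forall b : assignment G, feasible b -> potential m <= potential b) ->
  nash ne -> feasible o ->
  u * system_cost m + v * system_cost ne <= rho * system_cost o.
Proof.
move=> c0 ch slack nm pm nne fo.
have fm : feasible m by case/andP: nm.
have h1 := nash_system_cost ch nm fo.
have h2 := nash_system_cost ch nne fm.
have h3 := nash_system_cost ch nne fo.
have h4 := pm o fo.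
have : 0 <= \sum_e smooth_slack (@cost _ G e) (load m e) (load ne e) (load o e).
  by apply: sumr_ge0.
rewrite /smooth_slack !big_split /= ?sumrN -!mulr_sumr ?sumrB.
rewrite -!system_cost_load -/(potential m) -/(potential o).
move: h1 h2 h3 h4; rewrite -subr_le0 => h1; rewrite -subr_le0 => h2.
rewrite -subr_le0 => h3; rewrite -subr_le0 => h4.
have := mulr_ge0_le0 p0 h4; have := mulr_ge0_le0 s0 h1.
have := mulr_ge0_le0 q0 h2; have := mulr_ge0_le0 r0 h3.
lra.
Qed.

End Smoothness.

Section MonomialCosts.
Variables (R : realType) (d : nat).

Lemma cone_span_monomial_ge0 (l : nat -> R) k :
  cone_span (@monomial R d) l -> 0 <= l k.
Proof.
move=> [c c0 ->]; apply: sumr_ge0 => j _.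
by rewrite mulr_ge0 // exprn_ge0.
Qed.

Lemma cone_span_monomial_homo (l : nat -> R) :
  cone_span (@monomial R d) l -> {homo l : j k / (j <= k)%N >-> j <= k}.
Proof.
move=> [c c0 lE] x y xy; rewrite !lE; apply: ler_sum => j _.
by rewrite ler_wpM2l // lerXn2r ?nnegrE ?ler_nat.
Qed.

Lemma cone_span_smooth (u v rho p s q r : R) (l : nat -> R) :
  (forall j : 'I_d, forall x y z,
     0 <= smooth_slack u v rho p s q r (fun k => k%:R ^+ j) x y z) ->
  cone_span (@monomial R d) l ->
  forall x y z, 0 <= smooth_slack u v rho p s q r l x y z.
Proof.
move=> slack [c c0 lE] x y z.
have -> : l = (fun k => \sum_j c j * monomial R j k) by apply/funext => k; rewrite lE.
rewrite smooth_slack_sum; apply: sumr_ge0 => j _; rewrite mulr_ge0 //.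
exact: slack.
Qed.

End MonomialCosts.

(** * From cost inequalities to bounds on the price of stability *)

Section Ratios.
Variables (R : realType).
Implicit Types (G : game R) (F : game R -> Prop).

Lemma min_cost_attained G : exists2 o : assignment G, feasible o &
  min_cost G = (system_cost o)%:E.
Proof.
have [a0 fa0] := @exists_feasible _ G.
case: (arg_minP (@system_cost R G) fa0) => o fo oP; exists o => //.
apply/eqP; rewrite eq_le; apply/andP; split.
  exact: (bigmin_le_cond _ (fun a => (system_cost a)%:E) fo).
apply/bigmin_geP; split; first by rewrite leey.
by move=> a fa; rewrite lee_fin; exact: oP.
Qed.

(** If [y = 0] then [x = 0] and the ratio is 1 by convention; hence the hypothesis [1 <= rho]. *)
Lemma cost_ratio_le (x y rho : R) : 0 <= y -> 1 <= rho -> x <= rho * y -> 0 <= x ->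
  (cost_ratio x%:E y%:E <= rho%:E)%E.
Proof.
move=> y0 rho1 xy x0; rewrite /cost_ratio !eqe.
have [y_eq0|y_neq0] := eqVneq y 0.
  move: xy; rewrite y_eq0 mulr0 => x_le0.
  have -> : x = 0 by apply: le_anti; rewrite x_le0.
  by rewrite eqxx /= lee_fin.
rewrite andbF inver (negbTE y_neq0) -EFinM lee_fin ler_pdivrMr // lt_def y_neq0.
exact: y0.
Qed.

(** A finite ratio rules out [x / 0] with [x > 0], the only case in which the equation could
    fail. *)
Lemma cost_ratio_fin (x y tau : R) : 0 <= x -> 0 <= y ->
  cost_ratio x%:E y%:E = tau%:E -> x = tau * y.
Proof.
move=> x0 y0; rewrite /cost_ratio !eqe.
have [y_eq0|y_neq0] := eqVneq y 0; last first.
  by rewrite andbF inver (negbTE y_neq0) -EFinM => -[<-]; rewrite divfK.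
have [x_eq0|x_neq0] := eqVneq x 0 => /=.
  by move=> [<-]; rewrite x_eq0 y_eq0 mulr0.
rewrite y_eq0 inver eqxx gt0_muley //.
by rewrite lte_fin lt_def x_neq0.
Qed.

Lemma PoA_single G : PoA (eq G) = worst_ratio G.
Proof.
rewrite /PoA (_ : [set x | _]%classic = [set worst_ratio G]%classic) ?ereal_sup1 //.
by apply/seteqP; split => [x [_ <- ->]//|x ->]; exists G.
Qed.

Lemma best_ratio_le_worst G : (best_ratio G <= worst_ratio G)%E.
Proof.
have [m nm _] := @exists_potential_min _ G.
apply: (@le_trans _ _ (cost_ratio (system_cost m)%:E (min_cost G))).
  exact: (bigmin_le_cond _ (fun a => cost_ratio (system_cost a)%:E (min_cost G)) nm).
exact: (le_bigmax_cond _ (fun a => cost_ratio (system_cost a)%:E (min_cost G)) nm).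
Qed.

Lemma worst_ratio_attained G : exists2 ne : assignment G, nash ne &
  worst_ratio G = cost_ratio (system_cost ne)%:E (min_cost G).
Proof.
have [m nm _] := @exists_potential_min _ G.
case: (arg_maxP (fun a => cost_ratio (system_cost a)%:E (min_cost G)) nm) => ne nne neP.
exists ne => //; apply/eqP; rewrite eq_le; apply/andP; split.
  by apply/bigmax_leP; split; rewrite ?leNye // => a; exact: neP.
exact: (le_bigmax_cond _ (fun a => cost_ratio (system_cost a)%:E (min_cost G)) nne).
Qed.

Lemma PoS_le_tau F tau : (PoS (with_PoA F tau) <= tau%:E)%E.
Proof.
apply: ge_ereal_sup => _ [G [_ tauE] ->].
by rewrite -tauE PoA_single best_ratio_le_worst.
Qed.

Lemma PoS_with_PoA_le F tau : (PoS (with_PoA F tau) <= PoS F)%E.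
Proof.
by apply: le_ereal_sup => _ [G [FG _] ->]; exists G.
Qed.

Lemma PoS_smooth d (rho p s : R) : 0 <= p -> 0 <= s -> 1 <= rho ->
  (forall j : 'I_d, forall x y z,
     0 <= smooth_slack 1 0 rho p s 0 0 (fun k => k%:R ^+ j) x y z) ->
  (PoS (congestion_games (cone_span (@monomial R d))) <= rho%:E)%E.
Proof.
move=> p0 s0 rho1 slack; apply: ge_ereal_sup => _ [G LG ->].
have [m nm mP] := @exists_potential_min _ G.
apply: le_trans.
  exact: (bigmin_le_cond _ (fun a => cost_ratio (system_cost a)%:E (min_cost G)) nm).
have [y fy ->] := min_cost_attained G.
have c0 e k := cone_span_monomial_ge0 k (LG e).
apply: cost_ratio_le => //; try exact: system_cost_ge0.
(* The multipliers [v], [q] and [r] of the second equilibrium are 0, so [m] is passed in its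
   place. *)
have := @smooth_system_cost R 1 0 rho p s 0 0 p0 s0 (lexx _) (lexx _) G m m y c0
  (fun e => cone_span_monomial_homo (LG e))
  (fun e => cone_span_smooth slack (LG e)) nm mP nm fy.
by rewrite mul1r mul0r addr0.
Qed.

Lemma PoS_with_PoA_smooth d (v rho p q r tau : R) :
  0 <= p -> 0 <= q -> 0 <= r -> 1 <= rho - v * tau ->
  (forall j : 'I_d, forall x y z,
     0 <= smooth_slack 1 v rho p 0 q r (fun k => k%:R ^+ j) x y z) ->
  (PoS (with_PoA (congestion_games (cone_span (@monomial R d))) tau)
   <= (rho - v * tau)%:E)%E.
Proof.
move=> p0 q0 r0 tau1 slack; apply: ge_ereal_sup => _ [G [LG tauE] ->].
move: tauE; rewrite PoA_single.
have [ne nne ->] := worst_ratio_attained G.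
have [m nm mP] := @exists_potential_min _ G.
move=> neE; apply: le_trans.
  exact: (bigmin_le_cond _ (fun a => cost_ratio (system_cost a)%:E (min_cost G)) nm).
move: neE; have [y fy ->] := min_cost_attained G.
have c0 e k := cone_span_monomial_ge0 k (LG e).
have SC0 a := @system_cost_ge0 _ G c0 a.
move=> /(cost_ratio_fin (SC0 _) (SC0 _)) neE.
apply: cost_ratio_le => //.
have := @smooth_system_cost R 1 v rho p 0 q r p0 (lexx _) q0 r0 G m ne y c0
  (fun e => cone_span_monomial_homo (LG e))
  (fun e => cone_span_smooth slack (LG e)) nm mP nne fy.
rewrite neE; lra.
Qed.

End Ratios.

(** * Inequalities between the loads of a resource *)

Section MonomialSums.
Variable R : realType.

Lemma sum_expr0 n : \sum_(k < n) k.+1%:R ^+ 0 = n%:R :> R.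
Proof. by rewrite (eq_bigr (fun=> 1)) // sumr_const card_ord. Qed.

Lemma sum_expr1 n : \sum_(k < n) k.+1%:R ^+ 1 = n%:R * (n%:R + 1) / 2 :> R.
Proof.
elim: n => [|n ih]; first by rewrite big_ord0 !mul0r.
by rewrite big_ord_recr /= ih -natr1; field.
Qed.

Lemma sum_expr2 n :
  \sum_(k < n) k.+1%:R ^+ 2 = n%:R * (n%:R + 1) * (2 * n%:R + 1) / 6 :> R.
Proof.
elim: n => [|n ih]; first by rewrite big_ord0 !mul0r.
by rewrite big_ord_recr /= ih -natr1; field.
Qed.

(** A product of consecutive integers; the integrality of loads enters through it and through the
    case splits on 0, 1 and at least 2. *)
Lemma natr_sub_consec (x y : nat) : 0 <= (x%:R - y%:R) * (x%:R - y%:R + 1) :> R.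
Proof.
have [xy|yx] := leqP y x.
  by rewrite -natrB // mulr_ge0 // ?addr_ge0.
move: yx; rewrite -(ler_nat R) -natr1; nra.
Qed.

End MonomialSums.

Section MonomialSlack.
Variable R : realType.

(* For z >= 2, (a - 1/2) times the linear slack is a square plus a term linear
   in z; the quadratic form degenerates exactly when 4 (a^2 - 1/4) = a^2. *)
Lemma affine_slack (a : R) (j : 'I_2) x y z : 0 < a -> a ^+ 2 = 1 / 3 ->
  0 <= smooth_slack 1 0 (1 + a) 1 a 0 0 (fun k => k%:R ^+ j : R) x y z.
Proof.
move=> a0 a2.
have a_gt : 1 / 2 + 3 / 40 < a by nra.
have x0 := ler0n R x; have z0 := ler0n R z.
case: j => [[|[|//]] /= _]; rewrite /smooth_slack.
  rewrite !sum_expr0 !expr0; nra.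
rewrite !sum_expr1 !expr1 -[x.+1%:R]natr1.
have x1 := natr_sub_consec R x 1.
case: z z0 => [|[|z]] z0.
- nra.
- nra.
have {z0} : 2 <= z.+2%:R :> R by rewrite ler_nat.
move: (z.+2%:R) (y%:R : R) (x%:R) x0 {x1} => Z Y X X0 Z2.
rewrite -(pmulr_rge0 _ (_ : 0 < a - 1 / 2)); last by lra.
have := sqr_ge0 ((a - 1 / 2) * X - a * Z / 2 + 1 / 4).
nra.
Qed.

(** The multipliers are rounded decimals, since three digits are wanted. They satisfy [p + s = rho],
    which makes the slack 0 at [x = 0], [z = 1]. *)
Lemma quadratic_slack (j : 'I_3) x y z :
  0 <= smooth_slack 1 0 (23615 / 10000) (19077 / 10000) (4538 / 10000) 0 0
    (fun k => k%:R ^+ j : R) x y z.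
Proof.
have x0 := ler0n R x; have z0 := ler0n R z.
case: j => [[|[|[|//]]] /= _]; rewrite /smooth_slack.
- rewrite !sum_expr0 !expr0; nra.
- rewrite !sum_expr1 !expr1 -[x.+1%:R]natr1.
  have x1 := natr_sub_consec R x 1.
  case: z z0 => [|[|z]] z0; [nra | nra |].
  have {z0} : 2 <= z.+2%:R :> R by rewrite ler_nat.
  move: (z.+2%:R) (y%:R : R) (x%:R) x0 {x1} => Z Y X X0 Z2.
  have := sqr_ge0 (X - Z); have := sqr_ge0 (X - Z / 2).
  nra.
rewrite !sum_expr2 -[x.+1%:R]natr1.
have x1 := natr_sub_consec R x 1.
case: z z0 => [|[|z]] z0.
- have : 0 <= x%:R ^+ 3 :> R by rewrite exprn_ge0.
  nra.
- nra.
have {z0} : 2 <= z.+2%:R :> R by rewrite ler_nat.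
move: (z.+2%:R) (y%:R : R) (x%:R) x0 {x1} => Z Y X X0 Z2.
(* 3373/1000 rounds the minimiser [X / Z] of the cubic part, which nearly vanishes there. *)
have h1 : 0 <= X * (X - 3373 / 1000 * Z) ^+ 2 by rewrite mulr_ge0 ?sqr_ge0.
have h2 : 0 <= (Z - 2) * (X - 3373 / 1000 * Z) ^+ 2.
  by rewrite mulr_ge0 ?sqr_ge0 ?subr_ge0.
have Z0 : 0 <= Z by apply: le_trans Z2.
have h3 : 0 <= Z * (Z - 2) by rewrite mulr_ge0 ?subr_ge0.
have h4 := exprn_ge0 3 Z0; have h7 : 0 <= Z * X ^+ 2 by rewrite mulr_ge0 ?sqr_ge0.
have h5 := sqr_ge0 (X - 1174 / 1000 * Z); have h6 := sqr_ge0 Z.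
have h8 := mulr_ge0 X0 Z0; lra.
Qed.

(** Six times the linear slack is 3 (x - y) (x - y + 1) plus y^2 + 3 y - 6 y z + 17 z^2 - 15 z. For
    z = 1 the latter is (y - 1) (y - 2); for z >= 2 it exceeds (y - 3 z + 3/2)^2 by 8 z^2 - 6 z -
    9/4 > 0. *)
Lemma affine_tradeoff_slack (j : 'I_2) x y z :
  0 <= smooth_slack 1 (4 / 3) (13 / 3) 3 0 1 1 (fun k => k%:R ^+ j : R) x y z.
Proof.
have x0 := ler0n R x; have y0 := ler0n R y; have z0 := ler0n R z.
case: j => [[|[|//]] /= _]; rewrite /smooth_slack.
  rewrite !sum_expr0 !expr0; lra.
rewrite !sum_expr1 !expr1 -[x.+1%:R]natr1 -[y.+1%:R]natr1.
have xy := natr_sub_consec R x y.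
have y2 := natr_sub_consec R y 2.
case: z z0 => [|[|z]] z0.
- nra.
- nra.
have {z0} : 2 <= z.+2%:R :> R by rewrite ler_nat.
have := sqr_ge0 (y%:R - 3 * z.+2%:R + 3 / 2 : R).
move: (z.+2%:R) (y%:R : R) (x%:R) x0 y0 xy => Z Y X X0 Y0 xy sq Z2.
nra.
Qed.

(* 782/1000 and 315/1000 are rounded minimisers x / y, the first one of the cubic
   part 6 x^3 - 11 x y^2 + 574/100 y^3, which it makes almost a double root. *)
Lemma quadratic_tradeoff_xy (x y : R) : 0 <= x -> 2 <= y ->
  0 <= 6 * x ^+ 3 - 11 * x * y ^+ 2 + 574 / 100 * y ^+ 3
   + 63 * x ^+ 2 - 22 * x * y + 10 * x - 3 * y ^+ 2.
Proof.
move=> x0 y2; have y0 : 0 <= y by apply: le_trans y2.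
have h1 : 0 <= x * (x - 782 / 1000 * y) ^+ 2 by rewrite mulr_ge0 ?sqr_ge0.
have h2 : 0 <= (y - 2) * (x - 782 / 1000 * y) ^+ 2.
  by rewrite mulr_ge0 ?sqr_ge0 ?subr_ge0.
have h3 : 0 <= x * y ^+ 2 by rewrite mulr_ge0 ?sqr_ge0.
have h4 := sqr_ge0 (x - 315 / 1000 * y).
have h5 := mulr_ge0 x0 y0; have h6 := sqr_ge0 y; have h7 := exprn_ge0 3 y0.
lra.
Qed.

(** The term 7 y^3 is split: 574/100 of it balances the terms in x and y, the remaining 126/100
    those in y and z. *)
Lemma quadratic_tradeoff_opt_ge2 (x y z : R) : 0 <= x -> 2 <= y -> 2 <= z ->
  0 <= 6 * x ^+ 3 + 63 * x ^+ 2 + 21 * x + 7 * y ^+ 3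
    - (11 * x + 8 * z) * (y + 1) ^+ 2 + 109 * z ^+ 3 - 63 * z ^+ 2 - 21 * z.
Proof.
move=> x0 y2 z2.
have y0 : 0 <= y by apply: le_trans y2.
have z0 : 0 <= z by apply: le_trans z2.
have xy := quadratic_tradeoff_xy x0 y2.
have yz : 0 <= 126 / 100 * y ^+ 3 - 8 * z * y ^+ 2 + 109 * z ^+ 3
   + 3 * y ^+ 2 - 16 * z * y - 63 * z ^+ 2 - 29 * z.
  have h1 : 0 <= (z - 2) * (z - 1565 / 10000 * y) ^+ 2.
    by rewrite mulr_ge0 ?sqr_ge0 ?subr_ge0.
  have h2 : 0 <= y * (z - 1565 / 10000 * y) ^+ 2 by rewrite mulr_ge0 ?sqr_ge0.
  have h3 : 0 <= z * y ^+ 2 by rewrite mulr_ge0 ?sqr_ge0.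
  have h4 : 0 <= y * (y - 4 * z) ^+ 2 by rewrite mulr_ge0 ?sqr_ge0.
  have h4' : 0 <= z * (y - 4 * z) ^+ 2 by rewrite mulr_ge0 ?sqr_ge0.
  have h5 := sqr_ge0 (y - 4 * z).
  have h6 : 0 <= y * (y - 8) ^+ 2 by rewrite mulr_ge0 ?sqr_ge0.
  have h7 : 0 <= z * (z - 2) by rewrite mulr_ge0 ?subr_ge0.
  nra.
nra.
Qed.

(** This is the case z = 1, where the terms in z alone add up to 25. *)
Lemma quadratic_tradeoff_opt1 (x y : R) : 2 <= x -> 2 <= y ->
  0 <= 6 * x ^+ 3 + 63 * x ^+ 2 + 21 * x + 7 * y ^+ 3
    - (11 * x + 8) * (y + 1) ^+ 2 + 25.
Proof.
move=> x2 y2.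
have x0 : 0 <= x by apply: le_trans x2.
have y0 : 0 <= y by apply: le_trans y2.
have h1 : 0 <= (x - 2) * (x - 782 / 1000 * y) ^+ 2.
  by rewrite mulr_ge0 ?sqr_ge0 ?subr_ge0.
have h2 : 0 <= (y - 2) * (x - 782 / 1000 * y) ^+ 2.
  by rewrite mulr_ge0 ?sqr_ge0 ?subr_ge0.
have h3 : 0 <= x * y ^+ 2 by rewrite mulr_ge0 ?sqr_ge0.
have h4 : 0 <= y * (y - 3) ^+ 2 by rewrite mulr_ge0 ?sqr_ge0.
have h5 := mulr_ge0 x0 y0; have h6 := sqr_ge0 (x - 2).
have h7 : 0 <= (x - 2) * (y - 2) by rewrite mulr_ge0 ?subr_ge0.
have h8 := sqr_ge0 (x - 2 - 37 / 100 * (y - 3)).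
have h9 := sqr_ge0 (y - 3).
have h10 := sqr_ge0 (x - 37 / 100 * y).
nra.
Qed.

(* Zero slack is attained by the cubic at (x, y, z) = (0, 1, 1), (1, 2, 1) and
   (1, 3, 1), so small loads have to be treated as integers. *)
Lemma quadratic_tradeoff_slack (j : 'I_3) x y z :
  0 <= smooth_slack 1 (1 / 3) (151 / 36) (7 / 2) 0 (11 / 36) (2 / 9)
    (fun k => k%:R ^+ j : R) x y z.
Proof.
have x0 := ler0n R x; have y0 := ler0n R y; have z0 := ler0n R z.
case: j => [[|[|[|//]]] /= _]; rewrite /smooth_slack.
- rewrite !sum_expr0 !expr0; lra.
- rewrite !sum_expr1 !expr1 -[x.+1%:R]natr1 -[y.+1%:R]natr1.
  have z1 := natr_sub_consec R z 1; have xy := sqr_ge0 (x%:R - y%:R / 4 : R).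
  have := sqr_ge0 (y%:R - z%:R : R); have := sqr_ge0 (z%:R : R).
  have := sqr_ge0 (x%:R : R); have := sqr_ge0 (y%:R : R).
  have := sqr_ge0 (y%:R - 2 * z%:R : R).
  nra.
rewrite !sum_expr2 -[x.+1%:R]natr1 -[y.+1%:R]natr1.
set S := (X in 0 <= X).
have -> : S = (6 * x%:R ^+ 3 + 63 * x%:R ^+ 2 + 21 * x%:R + 7 * y%:R ^+ 3
    - (11 * x%:R + 8 * z%:R) * (y%:R + 1) ^+ 2 + 109 * z%:R ^+ 3
    - 63 * z%:R ^+ 2 - 21 * z%:R) / 36.
  by rewrite /S; field.
rewrite divr_ge0 //; move=> {S}.
have x3 := exprn_ge0 3 x0; have x5 := sqr_ge0 (x%:R - 1 / 5 : R).
have nat2 n : 2 <= n.+2%:R :> R by rewrite ler_nat.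
case: y y0 => [|[|y]] y0.
- case: z z0 => [|[|z]] z0.
  + nra.
  + nra.
  + have := nat2 z; nra.
- case: z z0 => [|[|z]] z0.
  + nra.
  + have := natr_sub_consec R x 1; nra.
  + have := nat2 z; nra.
have y2 := nat2 y.
case: z z0 => [|[|z]] z0; last exact: quadratic_tradeoff_opt_ge2.
  have := exprn_ge0 3 y0; have := quadratic_tradeoff_xy x0 y2; nra.
case: x x0 {x3 x5} => [|[|x]] _.
- nra.
(* For x = z = 1 and load y the polynomial is (y - 2) (y - 3) (7 y + 16). *)
- have := natr_sub_consec R y.+2 3; nra.
have := quadratic_tradeoff_opt1 (nat2 x) y2; lra.
Qed.

End MonomialSlack.

(** * Games with a unique and costly equilibrium *)

(** As [a] is the only possible equilibrium, [best_ratio] involves no other cost, and the optimum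
    costs at most as much as [o]. Positivity of the cost of [a] excludes 0 / 0. *)
Lemma PoS_ge (R : realType) (F : game R -> Prop) (G : game R)
    (a o : assignment G) (rho : R) :
  F G -> (forall (e : resource G) k, 0 <= cost e k) ->
  (forall b : assignment G, nash b -> b = a) -> feasible o ->
  0 < system_cost a -> rho * system_cost o <= system_cost a ->
  (rho%:E <= PoS F)%E.
Proof.
move=> FG c0 uniq fo a0 rho_le.
apply: (@le_trans _ _ (best_ratio G)); last first.
  by apply: ereal_sup_ubound; exists G.
apply/bigmin_geP; split; first by rewrite leey.
move=> b /uniq ->{b}.
have [y fy yE] := min_cost_attained G.
have yo : system_cost y <= system_cost o.
  rewrite -lee_fin -yE.
  exact: (bigmin_le_cond _ (fun a => (system_cost a)%:E) fo).
have y0 := system_cost_ge0 c0 y.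
rewrite yE /cost_ratio !eqe (gt_eqF a0) /= inver.
have [_|y_neq0] := eqVneq (system_cost y) 0.
  by rewrite gt0_muley ?leey.
have y_gt0 : 0 < system_cost y by rewrite lt_def y_neq0.
rewrite -EFinM lee_fin ler_pdivlMr //.
have [rho0|rho0] := leP 0 rho; first by apply: le_trans rho_le; rewrite ler_wpM2l.
by apply: le_trans (ltW a0); rewrite mulr_le0_ge0 // ltW.
Qed.

Section StabilityGame.
Variables (R : realType) (d f k : nat).
Hypothesis d12 : (d == 1%N) || (d == 2%N).
Local Notation n := (f + k)%N.

Definition power_step (j : nat) : R := j.+1%:R ^+ d - j%:R ^+ d.

(* A user j joining the shared resource when j others use it raises its cost by
   power_step j; the weights make the pair resources offset exactly this. *)
Definition pair_weight (i j : 'I_n) : R :=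
  if [&& (f <= i)%N, (f <= j)%N & i != j]
  then power_step (maxn i j) / (2 * (2 ^+ d - 1)) else 0.

(* The additive 1 makes the best response strict; without it, user i would be
   indifferent once the users before i, and they alone, have joined. *)
Definition private_cost (i : nat) : R :=
  (i.+1%:R ^+ d + n%:R ^+ d - (i%:R - f%:R) * power_step i) / 2 + 1.

Definition stability_resource : finType := (unit + ('I_n * 'I_n + 'I_n))%type.

Definition shared_res : stability_resource := inl tt.
Definition pair_res (i j : 'I_n) : stability_resource := inr (inl (i, j)).
Definition private_res (i : 'I_n) : stability_resource := inr (inr i).

Definition eq_action (i : 'I_n) : {set stability_resource} :=
  finset (fun e : stability_resource => match e with
         | inl _ => true | inr (inl p) => p.1 == i | inr (inr _) => false end).

Definition opt_action (i : 'I_n) : {set stability_resource} :=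
  finset (fun e : stability_resource => match e with
         | inl _ => false | inr (inl p) => p.2 == i | inr (inr u) => u == i end).

Definition stability_actions (i : 'I_n) : {set {set stability_resource}} :=
  if (i < f)%N then [set eq_action i] else [set eq_action i; opt_action i].

Lemma stability_actions_neq0 i : stability_actions i != finset.set0.
Proof.
apply/set0Pn; exists (eq_action i).
by rewrite /stability_actions; case: ifP => _; rewrite !inE eqxx.
Qed.

Definition stability_cost (e : stability_resource) (m : nat) : R :=
  match e with
  | inl _ => m%:R ^+ d
  | inr (inl p) => pair_weight p.1 p.2 * m%:R ^+ d
  | inr (inr u) => private_cost u
  end.

Definition stability_game : game R := Game stability_actions_neq0 stability_cost.

Lemma eq_action_shared i : shared_res \in eq_action i.
Proof. by rewrite inE. Qed.

Lemma eq_action_pair i u j : (pair_res u j \in eq_action i) = (u == i).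
Proof. by rewrite inE. Qed.

Lemma eq_action_private i u : (private_res u \in eq_action i) = false.
Proof. by rewrite inE. Qed.

Lemma opt_action_shared i : (shared_res \in opt_action i) = false.
Proof. by rewrite inE. Qed.

Lemma opt_action_pair i u j : (pair_res u j \in opt_action i) = (j == i).
Proof. by rewrite inE. Qed.

Lemma opt_action_private i u : (private_res u \in opt_action i) = (u == i).
Proof. by rewrite inE. Qed.

Lemma sum_stability_resource (P : pred stability_resource) (F : stability_resource -> R) :
  \sum_(e | P e) F e = (if P shared_res then F shared_res else 0) +
    (\sum_i \sum_(j | P (pair_res i j)) F (pair_res i j) +
     \sum_(i | P (private_res i)) F (private_res i)).
Proof.
rewrite !big_sumType /=; congr (_ + (_ + _)).
  by rewrite big_mkcond (big_pred1 tt) => [|[]].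
rewrite (eq_bigr (fun i => \sum_j if P (pair_res i j) then F (pair_res i j) else 0));
  last by move=> i _; rewrite big_mkcond.
by rewrite pair_big big_mkcond; apply: eq_bigr => -[].
Qed.

Lemma sum_eq_action i (F : stability_resource -> R) :
  \sum_(e in eq_action i) F e = F shared_res + \sum_j F (pair_res i j).
Proof.
rewrite (sum_stability_resource (mem (eq_action i))) /= inE; congr (_ + _).
rewrite [X in _ + X]big1 ?addr0; last by move=> u; rewrite inE.
rewrite (bigD1 i) //= [X in _ + X]big1 ?addr0; last first.
  by move=> u ui; rewrite big1 // => j; rewrite inE /= (negbTE ui).
by apply: eq_bigl => j; rewrite inE /= eqxx.
Qed.

Lemma sum_opt_action i (F : stability_resource -> R) :
  \sum_(e in opt_action i) F e = \sum_j F (pair_res j i) + F (private_res i).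
Proof.
rewrite (sum_stability_resource (mem (opt_action i))) /= inE add0r; congr (_ + _).
  by apply: eq_bigr => u _; rewrite (big_pred1 i) // => j; rewrite inE.
by rewrite (big_pred1 i) // => j; rewrite inE.
Qed.

Lemma power_step_ge0 j : 0 <= power_step j.
Proof. by rewrite subr_ge0 lerXn2r ?nnegrE ?ler_nat. Qed.

Lemma power_step_homo : {homo power_step : i j / (i <= j)%N >-> i <= j}.
Proof.
move=> i j ij; have {ij}: i%:R <= j%:R :> R by rewrite ler_nat.
rewrite /power_step -[i.+1%:R]natr1 -[j.+1%:R]natr1.
by case/orP: d12 => /eqP -> ij; rewrite ?expr1; lra.
Qed.

Lemma pair_denom_gt0 : 0 < 2 ^+ d - 1 :> R.
Proof. by case/orP: d12 => /eqP ->; rewrite ?expr1; lra. Qed.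

Lemma pair_weight_ge0 i j : 0 <= pair_weight i j.
Proof.
rewrite /pair_weight; case: ifP => // _; rewrite divr_ge0 ?power_step_ge0 //.
by rewrite mulr_ge0 // ltW // pair_denom_gt0.
Qed.

Lemma pair_weightC i j : pair_weight i j = pair_weight j i.
Proof. by rewrite /pair_weight maxnC eq_sym andbCA. Qed.

Lemma private_cost_ge0 (i : 'I_n) : 0 <= private_cost i.
Proof.
rewrite /private_cost /power_step -[i.+1%:R]natr1.
have i_n : i%:R + 1 <= n%:R :> R by rewrite natr1 ler_nat.
have i0 := ler0n R i; have f0 := ler0n R f.
move: (n%:R : R) (f%:R : R) (i%:R : R) i_n i0 f0 => N F I IN I0 F0.
by case/orP: d12 => /eqP ->; rewrite ?expr1; nra.
Qed.

Lemma stability_game_cone m : (d < m)%N ->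
  congestion_games (cone_span (@monomial R m)) stability_game.
Proof.
move=> dm; have m0 : (0 < m)%N by apply: leq_ltn_trans dm.
have cone (c : R) (j : 'I_m) : 0 <= c ->
    cone_span (@monomial R m) (fun x => c * x%:R ^+ j).
  move=> c0; exists (fun u => if u == j then c else 0).
    by move=> u; case: ifP.
  move=> x; rewrite (bigD1 j) //= eqxx big1 ?addr0 // => u /negbTE ->.
  by rewrite mul0r.
case=> [[]|[p|u]] /=.
- have := cone 1 (Ordinal dm) ler01.
  by congr (cone_span _ _); apply/funext => x; rewrite mul1r.
- exact: (cone _ (Ordinal dm) (pair_weight_ge0 _ _)).
- have := cone _ (Ordinal m0) (private_cost_ge0 u).
  by congr (cone_span _ _); apply/funext => x; rewrite expr0 mulr1.
Qed.

(** Let the joiners enter by increasing index: when [j] enters, at most [j] users are present, so by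
    convexity the power grows by at most [power_step j]. *)
Lemma power_sum_le (P : pred nat) i m : (i < m)%N ->
  (i.+1 + \sum_(i.+1 <= j < m) P j)%N%:R ^+ d <=
  i.+1%:R ^+ d + \sum_(i.+1 <= j < m) (P j)%:R * power_step j :> R.
Proof.
elim: m => [//|m ih]; rewrite ltnS leq_eqVlt => /predU1P[->|im].
  by rewrite !big_geq // addn0 addr0.
rewrite !big_nat_recr //=; have {ih} := ih im.
set t := (\sum_(_ <= _ < _) _)%N; set T := \sum_(_ <= _ < _) _.
case: (P m) => ih; last by rewrite addn0 mul0r addr0.
rewrite addn1 mul1r addrA addnS -lerBlDr; apply: le_trans ih.
rewrite lerBlDr -lerBlDl; apply: power_step_homo.
have -> : m = (i.+1 + (m - i.+1))%N by rewrite subnKC.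
rewrite leq_add2l /t; apply: leq_trans (leq_sum _ (fun j _ => leq_b1 (P j))) _.
by rewrite sum_nat_const_nat muln1.
Qed.

Lemma expr_addb (b : bool) : (b.+1)%:R ^+ d = 1 + (2 ^+ d - 1) * b%:R :> R.
Proof. by case: b; rewrite ?expr1n /=; ring. Qed.

(** For [j < i] the larger index is [i], so the [i - f] terms with [f <= j] are equal; the others
    vanish. *)
Lemma sum_pair_weight_lt (i : 'I_n) : (f <= i)%N ->
  (2 ^+ d - 1) * \sum_(j < n | (j < i)%N) pair_weight i j =
  (i%:R - f%:R) * power_step i / 2.
Proof.
move=> fi.
set c := power_step i / (2 * (2 ^+ d - 1)).
rewrite (eq_bigr (fun j : 'I_n => if (f <= j)%N then c else 0)).
  rewrite -big_mkcondr -(big_geq_mkord f n (fun j => (j < i)%N) (fun=> c)).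
  rewrite -(big_nat_widen f i n xpredT) ?(ltnW (ltn_ord i)) // sumr_const_nat.
  rewrite -(mulr_natl _ (i - f)) natrB // /c.
  have := pair_denom_gt0; move: (2 ^+ d - 1 : R) (power_step i) => D s D0.
  by field; rewrite gt_eqF.
move=> j ji; rewrite /pair_weight fi /= (maxn_idPl (ltnW ji)).
by rewrite -(inj_eq val_inj) neq_ltn /= ji orbT andbT.
Qed.

Section Dominance.
Variable a : assignment stability_game.
Hypothesis nash_a : nash a.

Lemma stability_action_cases (i : 'I_n) :
  a i = eq_action i \/ (f <= i)%N /\ a i = opt_action i.
Proof.
have : a i \in stability_actions i by case/andP: nash_a => /forallP/(_ i).
rewrite /stability_actions; case: ltnP => fi; rewrite !inE.
  by move/eqP; left.
by case/orP => /eqP; [left | right].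
Qed.

Definition eq_user (j : 'I_n) : bool := a j == eq_action j.

Lemma other_load_shared i :
  other_load a i shared_res = (\sum_(j | j != i) eq_user j)%N.
Proof.
rewrite /other_load -sum1_card big_mkcond [RHS]big_mkcond /=; apply: eq_bigr => j _.
rewrite inE; case: (j != i) => //=; rewrite /eq_user.
case: (stability_action_cases j) => [|[_]] aj; first by rewrite aj eq_action_shared eqxx.
rewrite aj opt_action_shared; case: eqP => // E.
by have := eq_action_shared j; rewrite -E opt_action_shared.
Qed.

(** Besides [i], only [j] can reach this resource, and only by [opt_action j]. *)
Lemma other_load_pair_le i j : j != i ->
  (other_load a i (pair_res i j) <= ~~ eq_user j)%N.
Proof.
move=> ji; rewrite /other_load -sum1_card big_mkcond (bigD1 j) //= big1 => [|u uj].
  rewrite addn0 inE ji /=; case: ifP => // pj.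
  rewrite lt0b; apply/eqP => E; move: pj.
  by rewrite E eq_action_pair eq_sym (negbTE ji).
rewrite inE; case: ifP => // /andP[ui]; case: (stability_action_cases u) => [|[_]] ->.
  by rewrite eq_action_pair eq_sym (negbTE ui).
by rewrite opt_action_pair eq_sym (negbTE uj).
Qed.

Lemma other_load_pair_ge i j : j != i ->
  (eq_user j <= other_load a i (pair_res j i))%N.
Proof.
move=> ji; rewrite /eq_user; case: eqP => // E.
by apply/card_gt0P; exists j; rewrite inE ji E eq_action_pair eqxx.
Qed.

(** This is the equilibrium inequality against joining. User [j] occupies (j, i) if it has joined
    and (i, j) otherwise, so its choice shifts the comparison by
    [2 * (2 ^ d - 1) * pair_weight i j]. *)
Lemma nash_dominance (i : 'I_n) : (f <= i)%N -> a i = opt_action i ->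
  private_cost i <= (\sum_(j | j != i) eq_user j).+1%:R ^+ d +
    \sum_j (2 ^+ d - 1) * pair_weight i j * (1 - 2 * (eq_user j)%:R).
Proof.
move=> fi ai; have /andP[_ /forallP/(_ i)/forall_inP/(_ (eq_action i))] := nash_a.
rewrite user_cost_deviate user_cost_other ai sum_opt_action sum_eq_action /=.
have -> : eq_action i \in stability_actions i.
  by rewrite /stability_actions; case: ifP => _; rewrite !inE eqxx.
move=> /(_ isT); rewrite other_load_shared addrC -lerBrDr => /le_trans; apply.
rewrite -addrA lerD2l -sumrB; apply: ler_sum => j _.
have [->|ji] := eqVneq j i.
  by rewrite /pair_weight eqxx !andbF !mul0r mulr0 mul0r subr0.
have w0 := pair_weight_ge0 i j; rewrite (pair_weightC j i) -mulrBr.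
rewrite mulrAC [leRHS]mulrC ler_wpM2l //.
have lo := other_load_pair_le ji; have up := other_load_pair_ge ji.
rewrite -ltnS in lo; rewrite -ltnS in up.
have {}lo : (other_load a i (pair_res i j)).+1%:R ^+ d <= (~~ eq_user j).+1%:R ^+ d :> R.
  by rewrite lerXn2r ?nnegrE ?ler_nat.
have {}up : (eq_user j).+1%:R ^+ d <= (other_load a i (pair_res j i)).+1%:R ^+ d :> R.
  by rewrite lerXn2r ?nnegrE ?ler_nat.
apply: le_trans (lerB lo up) _; rewrite !expr_addb.
by case: (eq_user j); rewrite /= ?mulr1n ?mulr0n; lra.
Qed.

(* The worst configuration for user i is the one where nobody after i has joined:
   by convexity of x^d each later joiner is at least offset by pair_weight. *)
Lemma nash_eq_action (i : 'I_n) : a i = eq_action i.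
Proof.
(* Strong induction on the index: all users before [i] have joined. *)
have [m] := ubnP (val i); elim: m i => // m ih i; rewrite ltnS => im.
have [//|[fi ai]] := stability_action_cases i.
have before (j : 'I_n) : (j < i)%N -> eq_user j.
  by move=> ji; apply/eqP/ih; apply: leq_trans im.
have := nash_dominance fi ai.
(* [P] extends [eq_user] to all naturals, as [power_sum_le] requires. *)
pose P m := [exists j : 'I_n, (val j == m) && eq_user j].
have PE (j : 'I_n) : eq_user j = P j.
  apply/idP/existsP => [uj|[j' /andP[/eqP/val_inj -> //]]].
  by exists j; rewrite eqxx.
have split_i (F : 'I_n -> R) : F i = 0 ->
    \sum_j F j = \sum_(j < n | (j < i)%N) F j + \sum_(j < n | (i < j)%N) F j.
  move=> Fi0; rewrite (bigID (fun j : 'I_n => (j < i)%N)) /=; congr (_ + _).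
  rewrite (bigD1 i) ?ltnn //= Fi0 add0r; apply: eq_bigl => j.
  by rewrite -leqNgt ltn_neqAle eq_sym andbC.
have -> : (\sum_(j | j != i) eq_user j = i + \sum_(i.+1 <= j < n) P j)%N.
  rewrite big_geq_mkord (bigID (fun j : 'I_n => (j < i)%N)) /=; congr addn.
    rewrite (eq_big (fun j : 'I_n => (j < i)%N) (fun=> 1%N)).
    - rewrite -(big_mkord (fun j => j < i)%N (fun=> 1%N)).
      rewrite -(big_nat_widen 0 i n xpredT) ?(ltnW (ltn_ord i)) //.
      by rewrite sum_nat_const_nat muln1 subn0.
    - by move=> j; rewrite -(inj_eq val_inj) neq_ltn /=; case: (j < i)%N; rewrite ?andbF.
    - by move=> j /andP[_ /before ->].
  apply: eq_big => [j|j _]; last by rewrite PE.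
  by rewrite -(inj_eq val_inj) -leqNgt ltn_neqAle eq_sym.
rewrite split_i; last by rewrite /pair_weight eqxx !andbF mulr0 mul0r.
rewrite -addSn => /le_trans/(_ (lerD (power_sum_le P (ltn_ord i)) (lexx _))).
have -> : \sum_(j < n | (j < i)%N)
    (2 ^+ d - 1) * pair_weight i j * (1 - 2 * (eq_user j)%:R) =
    - ((i%:R - f%:R) * power_step i / 2).
  rewrite -sum_pair_weight_lt // mulr_sumr -sumrN; apply: eq_bigr => j /before ->.
  by rewrite /=; ring.
have -> : \sum_(j < n | (i < j)%N)
    (2 ^+ d - 1) * pair_weight i j * (1 - 2 * (eq_user j)%:R) =
    (n%:R ^+ d - i.+1%:R ^+ d) / 2 - \sum_(i.+1 <= j < n) (P j)%:R * power_step j.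
  rewrite -(telescope_sumr (fun j => j%:R ^+ d) (ltn_ord i)) mulr_suml -sumrB.
  rewrite big_geq_mkord; apply: eq_bigr => j ij; rewrite -/(power_step j) -PE.
  rewrite /pair_weight fi (leq_trans fi (ltnW ij)) /= (maxn_idPr (ltnW ij)).
  rewrite -(inj_eq val_inj) neq_ltn ij /=.
  have := pair_denom_gt0; move: (2 ^+ d - 1 : R) (power_step j) => D s D0.
  by field; rewrite gt_eqF.
(* The terms of later joiners cancel; what is left reads [private_cost i <= private_cost i - 1]. *)
by rewrite /private_cost => h; exfalso; clear ai; lra.
Qed.

End Dominance.

Definition eq_profile : assignment stability_game := [ffun i => eq_action i].

Definition opt_profile : assignment stability_game :=
  [ffun i : 'I_n => if (i < f)%N then eq_action i else opt_action i].

Lemma nash_eq_profile (a : assignment stability_game) : nash a -> a = eq_profile.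
Proof. by move=> na; apply/ffunP => i; rewrite ffunE; apply: nash_eq_action. Qed.

Lemma feasible_opt_profile : feasible opt_profile.
Proof.
apply/forallP => i; rewrite ffunE /= /stability_actions.
by case: ifP => _; rewrite !inE eqxx ?orbT.
Qed.

Definition total_pair_weight : R := \sum_i \sum_j pair_weight i j.

Lemma system_cost_eq_profile :
  system_cost eq_profile = n%:R ^+ d.+1 + total_pair_weight.
Proof.
rewrite system_cost_load sum_stability_resource /=.
have -> : load eq_profile shared_res = n.
  rewrite /load -[RHS]card_ord; apply: eq_card => i.
  by rewrite inE ffunE eq_action_shared.
rewrite -exprS; congr (_ + _).
rewrite [X in _ + X]big1 ?addr0 => [|i _].
  apply: eq_bigr => i _; apply: eq_bigr => j _.
  have -> : load eq_profile (pair_res i j) = 1%N.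
    rewrite /load -(card1 i); apply: eq_card => u.
    by rewrite !inE ffunE eq_action_pair eq_sym.
  by rewrite expr1n mulr1 mul1r.
have -> : load eq_profile (private_res i) = 0%N.
  by apply: eq_card0 => u; rewrite inE ffunE eq_action_private.
by rewrite mul0r.
Qed.

(** Pair resources of nonzero weight have exactly one user here, as in [eq_profile], so
    [total_pair_weight] enters both costs. *)
Lemma system_cost_opt_profile :
  system_cost opt_profile =
  f%:R ^+ d.+1 + (total_pair_weight + \sum_(i < n | (f <= i)%N) private_cost i).
Proof.
rewrite system_cost_load sum_stability_resource /=.
have -> : load opt_profile shared_res = f.
  rewrite /load -sum1_card.
  rewrite (eq_bigl (fun i : 'I_n => (i < f)%N)) => [|i].
    rewrite -(big_mkord (fun i => i < f)%N (fun=> 1%N)).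
    by rewrite -(big_nat_widen 0 f n xpredT) ?leq_addr // sum_nat_const_nat muln1 subn0.
  rewrite !inE ffunE; case: ifP => _; first exact: eq_action_shared.
  by rewrite opt_action_shared.
rewrite -exprS; congr (_ + (_ + _)).
  apply: eq_bigr => i _; apply: eq_bigr => j _; rewrite /pair_weight.
  case: ifP => [/and3P[fi fj ij]|]; last by rewrite mul0r mulr0.
  have -> : load opt_profile (pair_res i j) = 1%N.
    rewrite /load -(card1 j); apply: eq_card => u; rewrite !inE ffunE.
    case: ltnP => fu; last by rewrite opt_action_pair eq_sym.
    rewrite eq_action_pair.
    have /negbTE -> : i != u by rewrite -(inj_eq val_inj) neq_ltn (leq_trans fu fi) orbT.
    by rewrite -(inj_eq val_inj) ltn_eqF //= (leq_trans fu fj).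
  by rewrite expr1n mulr1 mul1r.
rewrite [RHS]big_mkcond; apply: eq_bigr => i _.
have -> : load opt_profile (private_res i) = (f <= i)%N.
  rewrite /load; case: leqP => fi.
    rewrite -[nat_of_bool _](card1 i); apply: eq_card => u; rewrite !inE ffunE.
    case: ltnP => fu; last by rewrite opt_action_private eq_sym.
    by rewrite eq_action_private -(inj_eq val_inj) ltn_eqF //= (leq_trans fu fi).
  apply: eq_card0 => u; rewrite inE ffunE.
  case: ltnP => fu; first exact: eq_action_private.
  by rewrite opt_action_private -(inj_eq val_inj) ltn_eqF //= (leq_trans fi fu).
by case: (f <= i)%N; rewrite ?mul1r ?mul0r.
Qed.

Lemma sum_movers (F : nat -> R) :
  \sum_(i < n | (f <= i)%N) F i = \sum_(i < k) F (i + f)%N.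
Proof.
by rewrite -(big_geq_mkord f n xpredT) -{1}[f]add0n big_addn addKn big_mkord.
Qed.

(** By symmetry the total is twice the part below the diagonal, whose rows [sum_pair_weight_lt]
    evaluates. *)
Lemma total_pair_weightE :
  (2 ^+ d - 1) * total_pair_weight =
  \sum_(i < k) i%:R * power_step (i + f)%N.
Proof.
have -> : total_pair_weight = 2 * \sum_(i < n) \sum_(j < n | (j < i)%N) pair_weight i j.
  rewrite mulr_natl mulr2n {2}(exchange_big_dep xpredT) //= -big_split /=.
  apply: eq_bigr => i _; rewrite (bigID (fun j : 'I_n => (j < i)%N)) /=; congr (_ + _).
  rewrite (bigD1 i) ?ltnn //= {1}/pair_weight eqxx !andbF add0r.
  apply: eq_big => [j|j _]; last exact: pair_weightC.
  by rewrite -leqNgt ltn_neqAle eq_sym andbC.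
rewrite mulrCA mulr_sumr (bigID (fun i : 'I_n => (f <= i)%N)) /= [X in _ + X]big1; last first.
  move=> i fi; rewrite big1 ?mulr0 // => j _.
  by rewrite /pair_weight (negbTE fi).
rewrite addr0 (eq_bigr (fun i : 'I_n => (i%:R - f%:R) * power_step i / 2)); last first.
  by move=> i fi; rewrite sum_pair_weight_lt.
rewrite (sum_movers (fun i => (i%:R - f%:R) * power_step i / 2)) mulr_sumr.
by apply: eq_bigr => i _; rewrite natrD; field.
Qed.

End StabilityGame.

(** * Costs of the two profiles and their asymptotic ratio *)

Section LowerBounds.
Variable R : realType.

Lemma PoS_stability_game_ge (d f k m : nat) (rho : R) (d12 : (d == 1%N) || (d == 2%N)) :
  (d < m)%N -> (0 < k)%N ->
  rho * system_cost (opt_profile R d f k) <= system_cost (eq_profile R d f k) ->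
  (rho%:E <= PoS (congestion_games (cone_span (@monomial R m))))%E.
Proof.
move=> dm k0 rho_le.
have cone := @stability_game_cone R d f k d12 m dm.
apply: (PoS_ge cone _ _ (feasible_opt_profile R d f k) _ rho_le).
- by move=> e j; apply: cone_span_monomial_ge0 (cone e).
- exact: nash_eq_profile d12.
rewrite system_cost_eq_profile ltr_pwDl //.
  by rewrite exprn_gt0 // ltr0n addn_gt0 k0 orbT.
by apply: sumr_ge0 => i _; apply: sumr_ge0 => j _; apply: pair_weight_ge0 d12 _ _.
Qed.

Lemma sum_linear (k : nat) (a b : R) :
  \sum_(i < k) (a * i%:R + b) = a * k%:R * (k%:R - 1) / 2 + b * k%:R.
Proof.
elim: k => [|k ih]; first by rewrite big_ord0; ring.
by rewrite big_ord_recr /= ih -natr1; field.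
Qed.

Lemma sum_quadratic (k : nat) (a b c : R) :
  \sum_(i < k) (a * i%:R ^+ 2 + b * i%:R + c) =
  a * k%:R * (k%:R - 1) * (2 * k%:R - 1) / 6 + b * k%:R * (k%:R - 1) / 2 + c * k%:R.
Proof.
elim: k => [|k ih]; first by rewrite big_ord0; ring.
by rewrite big_ord_recr /= ih -natr1; field.
Qed.

Lemma affine_eq_cost (f k : nat) : system_cost (eq_profile R 1 f k) =
  (f%:R + k%:R) ^+ 2 + k%:R * (k%:R - 1) / 2.
Proof.
rewrite system_cost_eq_profile natrD; congr (_ + _).
have := @total_pair_weightE R 1 f k isT.
rewrite (eq_bigr (fun i : 'I_k => 1 * i%:R + 0)) => [|i _]; last first.
  by rewrite /power_step -natr1; ring.
by rewrite sum_linear; lra.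
Qed.

Lemma affine_opt_cost (f k : nat) : system_cost (opt_profile R 1 f k) =
  f%:R ^+ 2 + k%:R ^+ 2 + f%:R * k%:R + k%:R.
Proof.
rewrite system_cost_opt_profile (sum_movers f k (private_cost R 1 f k)).
have := @total_pair_weightE R 1 f k isT.
rewrite (eq_bigr (fun i : 'I_k => 1 * i%:R + 0)) => [|i _]; last first.
  by rewrite /power_step -natr1; ring.
rewrite [X in _ + (_ + X)](eq_bigr (fun i : 'I_k => 0 * i%:R + (2 * f%:R + k%:R + 3) / 2)).
  by rewrite !sum_linear; lra.
by move=> i _; rewrite /private_cost /power_step -natr1 !natrD; field.
Qed.

(** The factor 3 is [2 ^ d - 1] for [d = 2]; it clears the denominator of [total_pair_weight]. *)
Lemma quadratic_eq_cost (f k : nat) : 3 * system_cost (eq_profile R 2 f k) =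
  3 * (f%:R + k%:R) ^+ 3 + k%:R * (k%:R - 1) * (2 * k%:R - 1) / 3
  + (2 * f%:R + 1) * k%:R * (k%:R - 1) / 2.
Proof.
rewrite system_cost_eq_profile natrD.
have := @total_pair_weightE R 2 f k isT.
rewrite (eq_bigr (fun i : 'I_k => 2 * i%:R ^+ 2 + (2 * f%:R + 1) * i%:R + 0)) => [|i _].
  by rewrite sum_quadratic; lra.
by rewrite /power_step -natr1 natrD; ring.
Qed.

Lemma quadratic_opt_cost (f k : nat) : 3 * system_cost (opt_profile R 2 f k) =
  3 * f%:R ^+ 3 + k%:R * (k%:R - 1) * (2 * k%:R - 1) / 12
  + (2 * f%:R + 5 / 2) * k%:R * (k%:R - 1) / 2
  + 3 * k%:R * ((f%:R + 1) ^+ 2 + (f%:R + k%:R) ^+ 2 + 2) / 2.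
Proof.
rewrite system_cost_opt_profile (sum_movers f k (private_cost R 2 f k)).
have := @total_pair_weightE R 2 f k isT.
rewrite (eq_bigr (fun i : 'I_k => 2 * i%:R ^+ 2 + (2 * f%:R + 1) * i%:R + 0)) => [|i _];
  last by rewrite /power_step -natr1 natrD; ring.
rewrite [X in _ + (_ + X)](eq_bigr (fun i : 'I_k => - 2^-1 * i%:R ^+ 2 + 2^-1 * i%:R +
   ((f%:R + 1) ^+ 2 + (f%:R + k%:R) ^+ 2 + 2) / 2)).
  by rewrite !sum_quadratic; lra.
by move=> i _; rewrite /private_cost /power_step -natr1 !natrD; field.
Qed.

(* The limit of the ratio is about 2.3612 at f / (f + k) = 0.296, near 21/71. *)
Lemma PoS_quadratic_ge : ((23605 / 10000)%:E <= PoS (quadratic_games R))%E.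
Proof.
(* Both costs are cubic in [t], with leading terms in ratio about 2.3612; a large [t] absorbs the
   lower-order terms. *)
have [t t_ge] : exists t : nat, 10000 <= t%:R :> R by exists 10000%N.
have t0 : 0 < t%:R :> R by lra.
apply: (@PoS_stability_game_ge 2 (21 * t) (50 * t) 3) => //.
  by rewrite muln_gt0 /= -(ltr0n R).
have := quadratic_eq_cost (21 * t) (50 * t).
have := quadratic_opt_cost (21 * t) (50 * t).
rewrite !natrM; move: (t%:R) t_ge t0 => T T1 T0 oE eE.
have : 0 <= (T - 10000) * T ^+ 2 by rewrite mulr_ge0 ?sqr_ge0 ?subr_ge0.
have := mulr_ge0 (ltW T0) (_ : 0 <= T - 10000).
nra.
Qed.

(* f / k is close to (sqrt 3 - 1) / 2, which maximises the limit
   ((f + k)^2 + k^2 / 2) / (f^2 + k^2 + f k) of the ratio. *)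
Lemma PoS_affine_ge : ((1 + Num.sqrt 3 / 3)%:E <= PoS (affine_games R))%E.
Proof.
have s2 : Num.sqrt 3 ^+ 2 = 3 :> R by rewrite sqr_sqrtr.
have s0 : 0 <= Num.sqrt 3 :> R by exact: sqrtr_ge0.
move: (Num.sqrt 3) s0 s2 => s s0 s2.
have s1 : 1 <= s by nra.
have s3 : s <= 2 by nra.
apply/lee_subgt0Pr => e e0; rewrite -EFinB.
have [k k_ge] : exists k : nat, 20 / e + 1 <= k%:R.
  by exists (Num.bound (20 / e + 1)); rewrite ltW // archi_boundP // addr_ge0 // divr_ge0 // ltW.
have k1 : 1 <= k%:R :> R by apply: le_trans k_ge; rewrite lerDr divr_ge0 // ltW.
have {k_ge} ke : 20 <= k%:R * e by rewrite -ler_pdivrMr // (le_trans _ k_ge) // lerDl.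
have k0 : (0 < k)%N by rewrite -(ltr0n R); lra.
have tau0 : 0 <= (s - 1) / 2 * k%:R by rewrite mulr_ge0; lra.
have := trunc_itv tau0; set f := Num.trunc _ => /andP[f_le]; rewrite -[f.+1%:R]natr1 => f_gt.
apply: (@PoS_stability_game_ge 1 f k 2) => //.
rewrite affine_eq_cost affine_opt_cost.
move: (f%:R) (k%:R) k1 ke f_le f_gt (ler0n R f) => F K K1 Ke F_le F_gt F0.
pose D := (s - 1) / 2 * K - F.
have D0 : 0 <= D by rewrite /D; lra.
have D1 : D <= 1 by rewrite /D; lra.
(* [F = (s - 1) / 2 * K] is a double zero of the quadratic part, so only the square of the rounding
   error [D] and terms linear in [K] remain; [Ke] absorbs them. *)
have gap : (F + K) ^+ 2 + K * (K - 1) / 2 - (1 + s / 3) * (F ^+ 2 + K ^+ 2 + F * K + K)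
    = - (s / 3 * D ^+ 2) - 3 / 2 * K - s / 3 * K.
  by rewrite /D; field: s2.
have DD : D ^+ 2 <= 1 by rewrite expr_le1.
have sD : s / 3 * D ^+ 2 <= 1 by nra.
have sK : s * K <= 2 * K by rewrite ler_wpM2r //; lra.
have cost_ge : K ^+ 2 <= F ^+ 2 + K ^+ 2 + F * K + K by nra.
have : e * K ^+ 2 <= e * (F ^+ 2 + K ^+ 2 + F * K + K) by rewrite ler_wpM2l // ltW.
have : 20 * K <= K * e * K by rewrite ler_wpM2r //; lra.
lra.
Qed.
End LowerBounds.

Lemma approx3_between (R : realType) (x : \bar R) (v : R) :
  ((v - 1 / 2000)%:E <= x)%E -> (x <= (v + 1 / 2000)%:E)%E -> approx3 x v.
Proof.
rewrite /approx3; case: x => [r| |] //; rewrite !lee_fin => lo up.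
by rewrite ler_norml; lra.
Qed.

Theorem corollary2 (R : realType) :
  ((forall tau : R, 1 <= tau <= 5 / 2 ->
      (PoS (with_PoA (affine_games R) tau) <=
       mine tau%:E
         (mine (PoS (affine_games R)) (- (4 / 3) * tau + 13 / 3)%:E))%E)
   /\ PoS (affine_games R) = (1 + Num.sqrt 3 / 3)%:E
   /\ approx3 (PoS (affine_games R)) (1577 / 1000))
  /\
  ((forall tau : R, 1 <= tau <= 115 / 12 ->
      (PoS (with_PoA (quadratic_games R) tau) <=
       mine tau%:E
         (mine (PoS (quadratic_games R)) (- (1 / 3) * tau + 151 / 36)%:E))%E)
   /\ approx3 (PoS (quadratic_games R)) (2361 / 1000)).
Proof.
have s2 : Num.sqrt 3 ^+ 2 = 3 :> R by rewrite sqr_sqrtr.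
have s_gt0 : 0 < Num.sqrt 3 :> R by rewrite sqrtr_gt0.
have PoS_affine : PoS (affine_games R) = (1 + Num.sqrt 3 / 3)%:E.
  apply/eqP; rewrite eq_le PoS_affine_ge andbT.
  apply: (@PoS_smooth _ 2 _ 1 (Num.sqrt 3 / 3)) => [| | |j x y z] //; try by lra.
  by apply: affine_slack; [rewrite divr_gt0 | rewrite exprMn s2; lra].
split; split; [|split=> //| |].
- move=> tau /andP[tau1 tau2]; rewrite !le_min PoS_le_tau PoS_with_PoA_le /=.
  rewrite (_ : _ + _ = 13 / 3 - 4 / 3 * tau); last by lra.
  (* The bound equals 1 at [tau = 5 / 2], so the side condition [1 <= rho - v * tau] just holds; the
     same happens below at 115/12. *)
  apply: (@PoS_with_PoA_smooth _ 2 _ _ 3 1 1); try by lra.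
  exact: affine_tradeoff_slack.
- by rewrite PoS_affine; apply: approx3_between; rewrite lee_fin; nra.
- move=> tau /andP[tau1 tau2]; rewrite !le_min PoS_le_tau PoS_with_PoA_le /=.
  rewrite (_ : _ + _ = 151 / 36 - 1 / 3 * tau); last by lra.
  apply: (@PoS_with_PoA_smooth _ 3 _ _ (7 / 2) (11 / 36) (2 / 9)); try by lra.
  exact: quadratic_tradeoff_slack.
apply: approx3_between.
  by apply: le_trans (PoS_quadratic_ge R); rewrite lee_fin; lra.
apply: (@le_trans _ _ (23615 / 10000)%:E); last by rewrite lee_fin; lra.
apply: (@PoS_smooth _ 3 _ (19077 / 10000) (4538 / 10000)); try by lra.
by move=> j x y z; apply: quadratic_slack.
Qed.
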